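(* Let $L/k$ be an extension of difference fields such that $\lfloor L\rfloor/\lfloor k\rfloor$ is separably algebraic and $L$ is finitely $\boldsymbol{\sigma}$-generated as a $k$-algebra. Then $$h(L)=\log(\mathrm{ld}(L/k)),$$ where $h(L)$ is the entropy of the $k$-algebra $L$ and $\mathrm{ld}(L/k)$ is the limit degree of $L/k$.
   Context: A difference field is a field with an endomorphism $\sigma$; $\lfloor R\rfloor$ is the underlying ring of a difference ring $R$. A $k$-algebra is a difference ring $A$ with a difference ring morphism $k\to A$. $A$ is finitely $\boldsymbol{\sigma}$-generated if $\lfloor A\rfloor=\lfloor k\rfloor[a,\sigma(a),\sigma^2(a),\dots]$ for some finite tuple $a$ in $A$. Limit degree: if $a$ is a finite tuple with $L=\lfloor k\rfloor[a,\sigma(a),\sigma^2(a),\dots]$, put $L_i=\lfloor k\rfloor[a,\sigma(a),\dots,\sigma^i(a)]$ and $d_i=[L_i:L_{i-1}]$. The sequence $d_i$ is non-increasing, hence eventually constant, with eventual value independent of $a$; $\mathrm{ld}(L/k)=\lim_id_i$. Entropy: let $\bar{k}$ be a separable closure of $k$, i.e. a separable algebraic closure of $\lfloor k\rfloor$ with an endomorphism $\bar{\sigma}$ extending $\sigma_k$. For a finitely $\boldsymbol{\sigma}$-generated $k$-algebra $A$ with $\lfloor A\rfloor$ ind-étale over $\lfloor k\rfloor$ (every element satisfies a separable polynomial over $\lfloor k\rfloor$), let $X(A)$ be the profinite space $\lfloor k\rfloor\text{-}\mathbf{Alg}(\lfloor A\rfloor,\lfloor\bar{k}\rfloor)$ (limit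 of the finite sets $\lfloor k\rfloor\text{-}\mathbf{Alg}(A_\lambda,\lfloor\bar{k}\rfloor)$ over the finite-dimensional subalgebras $A_\lambda\subseteq\lfloor A\rfloor$), with the continuous self-map $h\mapsto h^\sigma$ determined by $\bar{\sigma}\circ h^\sigma=h\circ\sigma_A$. Then $X(A)$ is isomorphic to a subshift, i.e. a closed shift-stable subset $X$ of $E_0^{\mathbb{N}}$ ($E_0$ finite, $\sigma(x_0,x_1,\dots)=(x_1,x_2,\dots)$). The entropy of $A$ is $h(A)=h(X)$, the topological entropy $h(X)=\lim_{l\to\infty}\frac1l\log|W(X,l)|$, where $W(X,l)$ is the set of words of length $l$ appearing in points of $X$. This does not depend on the choices made. *)

(* Defs.v *)
From HB Require Import structures.
From mathcomp Require Import all_boot all_order all_algebra all_field.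
From mathcomp Require Import all_classical all_reals all_analysis.

Set Implicit Arguments.
Unset Strict Implicit.
Unset Printing Implicit Defensive.

Import Order.TTheory GRing.Theory Num.Theory.
Import numFieldNormedType.Exports.

Local Open Scope classical_set_scope.
Local Open Scope ring_scope.

(* A difference ring is a commutative ring together with a ring endomorphism; *)
(* a difference ring morphism is a ring morphism that commutes with the       *)
(* endomorphisms. A k-algebra A is given by its structure map f : k -> A, and *)
(* k-subalgebras are represented as sets of elements of A.                    *)

Definition diff_morphism (A B : comNzRingType) (sA : {rmorphism A -> A})
    (sB : {rmorphism B -> B}) (f : {rmorphism A -> B}) :=
  {morph f : x / sA x >-> sB x}.

Section Algebras.
Variables (k : fieldType) (A : comNzRingType) (f : {rmorphism k -> A}).

Definition subalgebra (B : set A) :=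
  [/\ range f `<=` B,
      forall x y, B x -> B y -> B (x + y)
    & forall x y, B x -> B y -> B (x * y)].

Definition finite_dim (B : set A) :=
  exists (n : nat) (b : 'I_n -> A),
    B = range (fun c : 'I_n -> k => \sum_(i < n) f (c i) * b i).

Definition separably_algebraic :=
  forall x : A, exists2 p : {poly k},
    separable_poly p & root (map_poly f p) x.

Variable sA : {rmorphism A -> A}.

(* k[a, sigma(a), ..., sigma^i(a)], as a ring *)
Definition sigma_gen_upto (a : seq A) (i : nat) : set A :=
  smallest subalgebra
    [set y | exists2 x, x \in a & exists2 m, (m <= i)%N & y = iter m sA x].

(* k[a, sigma(a), sigma^2(a), ...], as a ring *)
Definition sigma_gen (a : seq A) : set A :=
  smallest subalgebra [set y | exists2 x, x \in a & exists m, y = iter m sA x].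

Definition finitely_sigma_generated := exists a : seq A, sigma_gen a = setT.

End Algebras.

Section SeparableClosure.
Variables (k K : fieldType) (j : {rmorphism k -> K}).

Definition separably_closed :=
  forall p : {poly K}, separable_poly p -> (1 < size p)%N ->
    exists x, root p x.

Definition separable_closure := separably_algebraic j /\ separably_closed.

End SeparableClosure.

Section LimitDegree.

Definition is_basis (L : fieldType) (E F : set L) (n : nat) (b : 'I_n -> L) :=
  [/\ forall i, F (b i),
      forall x, F x -> exists2 c : 'I_n -> L,
        (forall i, E (c i)) & x = \sum_(i < n) c i * b i
    & forall c : 'I_n -> L, (forall i, E (c i)) ->
        \sum_(i < n) c i * b i = 0 -> forall i, c i = 0].

(* [F : E] for subfields E `<=` F of L; the value is 0 if it is infinite. *)
Definition ext_degree (L : fieldType) (E F : set L) : nat :=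
  xget 0%N [set n | exists b : 'I_n -> L, is_basis E F b].

Variables (k L : fieldType) (f : {rmorphism k -> L}) (sL : {rmorphism L -> L}).

(* The eventual value of d_i = [L_i : L_(i-1)] for some generating tuple a;   *)
(* it does not depend on a.                                                   *)
Definition limit_degree : nat :=
  xget 0%N [set d | exists2 a : seq L, sigma_gen f sL a = setT &
    \forall i \near \oo,
      ext_degree (sigma_gen_upto f sL a i) (sigma_gen_upto f sL a i.+1) = d].

End LimitDegree.

Section Subshifts.
Variable E0 : finType.

Definition full_shift : topologicalType :=
  prod_topology (fun _ : nat => discrete_topology E0).

Definition shift_map (x : full_shift) : full_shift := fun n => x n.+1.

Definition subshift (X : set full_shift) := closed X /\ shift_map @` X `<=` X.

(* w is one of the words of length l in W(X, l) *)
Definition appears (X : set full_shift) (l : nat) (w : l.-tuple E0) :=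
  exists2 x, X x & exists m, forall i : 'I_l, x (m + i)%N = tnth w i.

Definition num_words (X : set full_shift) (l : nat) : nat :=
  #|[pred w : l.-tuple E0 | `[< appears X w >]]|.

Definition subshift_entropy (R : realType) (X : set full_shift) : R :=
  limn (fun l : nat => (l%:R)^-1 * ln (num_words X l)%:R).

End Subshifts.

Section Entropy.
Variables (k : fieldType) (A : comNzRingType) (K : fieldType).
Variables (f : {rmorphism k -> A}) (j : {rmorphism k -> K}).
Variables (sA : {rmorphism A -> A}) (sK : {rmorphism K -> K}).

Definition alg_hom (h : A -> K) :=
  [/\ GRing.zmod_morphism h, GRing.monoid_morphism h & forall c, h (f c) = j c].

Definition points : choiceType := set_type [set h | alg_hom h].

Definition fd_subalgebra : Type :=
  set_type [set B : set A | subalgebra f B /\ finite_dim f B].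

(* The limit of the sets of k-algebra morphisms B -> K, B ranging over the    *)
(* finite-dimensional subalgebras, is topologized inside the product of these *)
(* discrete sets, through the restriction maps.                               *)
Definition restrictions (h : points) :
    prod_topology (fun B : fd_subalgebra =>
      discrete_topology (set_type (set_val B) -> K)) :=
  fun B x => set_val h (set_val x).

Definition point_space : topologicalType := initial_topology restrictions.

(* h |-> h^sigma, the solution of sK \o h^sigma = h \o sA: it is unique as sK *)
(* is injective, and exists when K is a separable closure of k and A is       *)
(* ind-etale; h itself is only a default value.                               *)
Definition twist (h : points) : points :=
  xget h [set h' : points | forall x, sK (set_val h' x) = set_val h (sA x)].

(* X(A) is isomorphic to X: homeomorphic, equivariantly *)
Definition presents (E0 : finType) (X : set (full_shift E0)) :=
  exists (phi : point_space -> set_type X) (psi : set_type X -> point_space),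
    [/\ cancel phi psi, cancel psi phi, continuous phi, continuous psi
      & forall h, set_val (phi (twist h)) = shift_map (set_val (phi h))].

(* The entropy of some subshift isomorphic to X(A); it does not depend on the *)
(* subshift.                                                                  *)
Definition entropy (R : realType) : R :=
  xget 0 [set r | exists (E0 : finType) (X : set (full_shift E0)),
    [/\ subshift X, presents X & r = subshift_entropy R X]].

End Entropy.

(* Main.v *)
From HB Require Import structures.
Require Import Defs.
From mathcomp Require Import all_boot all_order all_algebra all_field.
From mathcomp Require Import all_classical all_reals all_analysis.

Set Implicit Arguments.
Unset Strict Implicit.
Unset Printing Implicit Defensive.

Import Order.TTheory GRing.Theory Num.Theory.
Import numFieldNormedType.Exports.

(** Both sides count extensions of embeddings. Fix a generating tuple a of L, let
    L_l be k[a, ..., sigma^(l-1)(a)] and let d_l be the degree of L_(l+1) over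
    L_l. As L is separably algebraic over k, each L_l is a field, and each
    k-morphism from L_l to the separably closed field kbar has exactly d_l
    extensions to L_(l+1): adjoining one element x, an extension is the choice of
    a root of the transported minimal polynomial of x, and there are as many of
    those as the degree ([simple_extension]); both the degree and the number of
    extensions are multiplicative ([finite_extension]). So there are
    d_0 * ... * d_(l-1) morphisms from L_l to kbar ([stage_values_enum]), and each
    of them extends to L ([stage_hom_extends]).

    Encode a k-morphism h : L -> kbar by its itinerary, the sequence of the tuples
    h^(sigma^i)(a). Since sbar^i (h^(sigma^i)(a)) = h (sigma^i(a)) and sbar is
    injective, the first l letters of the itinerary determine, and are determined
    by, the restriction of h to L_l. Hence itineraries form a subshift that
    presents X(L) ([subshift_itinerary], [presents_itinerary]), and its words of
    length l correspond to the morphisms from L_l to kbar, so that there are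
    exactly d_0 * ... * d_(l-1) of them ([num_words_itinerary]). As d_l is
    non-increasing ([stage_degree_noninc]), it is eventually a constant d, and the
    entropy of this subshift is log d.

    Finally, the entropy and the limit degree are defined through some presenting
    subshift and some generating tuple, so the equality is needed for an arbitrary
    pair of those ([presented_entropy]). Two subshifts that present X(L) are
    conjugate, and a conjugacy is given by a sliding block code, by compactness of
    the subshift; this bounds the number of words of length l of one by the number
    of words of length l + m of the other ([factor_num_words]), which leaves the
    growth rate unchanged ([log_growth]). *)

Local Open Scope classical_set_scope.
Local Open Scope ring_scope.

(** * Subalgebras and partial morphisms *)
Section Subalgebras.
Variables (k : fieldType) (A : comNzRingType) (f : {rmorphism k -> A}).
Implicit Types (M B G : set A) (s t : seq A).

Lemma subalgebra_base M c : subalgebra f M -> M (f c).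
Proof. by move=> [fM _ _]; apply: fM; exists c. Qed.

Lemma subalgebra0 M : subalgebra f M -> M 0.
Proof. by move=> /(subalgebra_base 0); rewrite rmorph0. Qed.

Lemma subalgebra1 M : subalgebra f M -> M 1.
Proof. by move=> /(subalgebra_base 1); rewrite rmorph1. Qed.

Lemma subalgebraN M x : subalgebra f M -> M x -> M (- x).
Proof.
move=> MS Mx; have [_ _ MM] := MS; rewrite -mulN1r -(rmorph1 f) -rmorphN.
by apply: MM => //; exact: subalgebra_base.
Qed.

Lemma subalgebraX M x n : subalgebra f M -> M x -> M (x ^+ n).
Proof.
move=> MS Mx; elim: n => [|n IHn]; first exact: subalgebra1.
by rewrite exprS; case: MS => _ _; apply.
Qed.

Lemma subalgebra_sum M (I : Type) (r : seq I) (P : pred I) (F : I -> A) :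
  subalgebra f M -> (forall i, M (F i)) -> M (\sum_(i <- r | P i) F i).
Proof.
move=> MS MF; elim/big_ind: _ => //; first exact: subalgebra0.
by case: MS.
Qed.

Lemma subalgebra_smallest G : subalgebra f (smallest (subalgebra f) G).
Proof.
split=> [x [c _ <-]|x y Sx Sy|x y Sx Sy] M [MS GM].
- exact: subalgebra_base.
- by have [_ MD _] := MS; apply: MD; [apply: Sx | apply: Sy].
- by have [_ _ MM] := MS; apply: MM; [apply: Sx | apply: Sy].
Qed.

Definition adjoin_seq M s : set A := smallest (subalgebra f) (M `|` [set` s]).

Lemma subalgebra_adjoin_seq M s : subalgebra f (adjoin_seq M s).
Proof. exact: subalgebra_smallest. Qed.

Lemma sub_adjoin_seq M s : M `<=` adjoin_seq M s.
Proof. by move=> x Mx; apply: sub_gen_smallest; left. Qed.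

Lemma mem_adjoin_seq M s x : x \in s -> adjoin_seq M s x.
Proof. by move=> sx; apply: sub_gen_smallest; right. Qed.

Lemma adjoin_seq_sub M s B :
  subalgebra f B -> M `<=` B -> [set` s] `<=` B -> adjoin_seq M s `<=` B.
Proof. by move=> BS MB sB; apply: smallest_sub => // x []; [exact: MB|exact: sB]. Qed.

Lemma adjoin_seq_nil M : subalgebra f M -> adjoin_seq M [::] = M.
Proof. by move=> MS; apply/seteqP; split; [exact: adjoin_seq_sub|exact: sub_adjoin_seq]. Qed.

Lemma adjoin_seq_cons M x s : adjoin_seq M (x :: s) = adjoin_seq (adjoin_seq M [:: x]) s.
Proof.
apply/seteqP; split; apply: adjoin_seq_sub; rewrite ?subset0 //; try exact: subalgebra_adjoin_seq.
- by move=> y My; do 2!apply: sub_adjoin_seq.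
- move=> y /=; rewrite inE => /orP[/eqP ->|ys]; last exact: mem_adjoin_seq.
  by apply: sub_adjoin_seq; apply: mem_adjoin_seq; rewrite inE.
- apply: adjoin_seq_sub; [exact: subalgebra_adjoin_seq|exact: sub_adjoin_seq|].
  by move=> y /=; rewrite inE => /eqP ->; apply: mem_adjoin_seq; rewrite mem_head.
- by move=> y /= ys; apply: mem_adjoin_seq; rewrite inE ys orbT.
Qed.

Lemma smallest_adjoin_seq G s :
  smallest (subalgebra f) (G `|` [set` s]) = adjoin_seq (smallest (subalgebra f) G) s.
Proof.
apply/seteqP; split.
  apply: smallest_sub; first exact: subalgebra_adjoin_seq.
  move=> x [Gx|xs]; last exact: mem_adjoin_seq.
  by apply: sub_adjoin_seq; exact: sub_gen_smallest.
apply: adjoin_seq_sub; first exact: subalgebra_smallest.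
  apply: smallest_sub; first exact: subalgebra_smallest.
  by move=> x Gx; apply: sub_gen_smallest; left.
by move=> x xs; apply: sub_gen_smallest; right.
Qed.

End Subalgebras.

Section PartialHom.
Variables (k : fieldType) (A : comNzRingType) (K : fieldType).
Variables (f : {rmorphism k -> A}) (j : {rmorphism k -> K}).
Implicit Types (M B G : set A) (h : A -> K).

(** A morphism from the subalgebra M to K is encoded as a function on the whole of
    A whose values off M are arbitrary; restriction is then the identity. *)
Definition hom_on M h :=
  [/\ forall c, h (f c) = j c,
      forall x y, M x -> M y -> h (x + y) = h x + h y
    & forall x y, M x -> M y -> h (x * y) = h x * h y].

Lemma hom_on_sub M B h : M `<=` B -> hom_on B h -> hom_on M h.
Proof. by move=> MB [hj hD hM]; split=> // x y /MB Bx /MB By; [apply: hD|apply: hM]. Qed.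

Lemma hom_onTP h : hom_on setT h <-> alg_hom f j h.
Proof.
split=> [[hj hD hM]|[hB [h1 hM] hj]].
  have h0 : h 0 = 0 by rewrite -(rmorph0 f) hj rmorph0.
  split=> //; last by split=> [|x y]; [rewrite -(rmorph1 f) hj rmorph1|exact: hM].
  by move=> x y; apply: (@addIr _ (h y)); rewrite -hD // !subrK.
have h0 : h 0 = 0 by rewrite -(subrr 0) hB subrr.
have hN x : h (- x) = - h x by rewrite -(sub0r x) hB h0 sub0r.
by split=> // x y _ _; rewrite -{1}(opprK y) hB hN opprK.
Qed.

(** The elements on which two morphisms agree form a subalgebra. *)
Lemma hom_on_eq_gen G h h' :
  hom_on (smallest (subalgebra f) G) h -> hom_on (smallest (subalgebra f) G) h' ->
  (forall x, G x -> h x = h' x) ->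
  forall x, smallest (subalgebra f) G x -> h x = h' x.
Proof.
set S := smallest _ _ => -[hj hD hM] [hj' hD' hM'] Ghh' x Sx.
have SS : subalgebra f S by exact: subalgebra_smallest.
have [fS SD SM] := SS.
have : (S `&` [set y | h y = h' y]) x.
  move: x Sx; apply: smallest_sub; last by move=> x Gx; split; [exact: sub_gen_smallest|exact: Ghh'].
  split=> [_ [c _ <-]|x y [Sx /= hx] [Sy /= hy]|x y [Sx /= hx] [Sy /= hy]].
  - by split=> /=; [exact: subalgebra_base|rewrite hj hj'].
  - by split=> /=; [exact: SD|rewrite hD ?hD' ?hx ?hy].
  - by split=> /=; [exact: SM|rewrite hM ?hM' ?hx ?hy].
by case.
Qed.

Lemma hom_on_horner M h (F : fieldType) (iota : {rmorphism F -> A})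
    (g : {rmorphism F -> K}) x (q : {poly F}) :
  subalgebra f M -> hom_on M h -> (forall e, M (iota e)) ->
  (forall e, h (iota e) = g e) -> M x ->
  M (map_poly iota q).[x] /\ h (map_poly iota q).[x] = (map_poly g q).[h x].
Proof.
move=> MS [hj hD hM] iM hg Mx; have [_ MD MM] := MS.
elim/poly_ind: q => [|q c [IHM IHh]].
  rewrite !rmorph0 !horner0; split; first exact: (subalgebra0 MS).
  by rewrite -(rmorph0 iota) hg rmorph0.
rewrite !rmorphD !rmorphM /= !map_polyX !map_polyC /= !hornerE.
have MqX : M ((map_poly iota q).[x] * x) by exact: MM.
by split; [apply: MD|rewrite hD // hM // IHh hg].
Qed.

End PartialHom.

(** * Simple extensions *)
Section Separable.
Variables (K : fieldType).

(** A separable polynomial over a separably closed field splits, because the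
    cofactor of one of its roots is again separable. *)
Lemma separably_closed_split (q : {poly K}) :
  separably_closed K -> separable_poly q ->
  exists rs : seq K,
    [/\ uniq rs, size rs = (size q).-1 & q = lead_coef q *: \prod_(r <- rs) ('X - r%:P)].
Proof.
move=> Kc; have [n] := ubnP (size q); elim: n q => // n IHn q szq sep_q.
have q0 : q != 0 by exact: separable_poly_neq0.
have [q1|q1] := leqP (size q) 1.
  exists [::]; split => //; first by move: q1; case: (size q) => [|[]].
  by rewrite big_nil alg_polyC; have /size1_polyC -> := q1; rewrite lead_coefC.
have [r] := Kc q sep_q q1; case/factor_theorem => q' qE.
move: (sep_q); rewrite qE separable_root => /andP[sep_q' nr].
have q'0 : q' != 0 by exact: separable_poly_neq0.
have szqE : size q = (size q').+1 by rewrite qE size_mul ?polyXsubC_eq0 // size_XsubC addnC.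
have [|rs [urs srs q'E]] := IHn q' _ sep_q'; first by rewrite -ltnS -szqE.
exists (r :: rs); split.
- rewrite /= urs andbT; apply: contra nr => rrs; rewrite q'E rootZ ?lead_coef_eq0 //.
  by rewrite root_prod_XsubC.
- by rewrite /= srs -qE szqE /= prednK // size_poly_gt0.
- rewrite lead_coefM lead_coefXsubC mulr1 big_cons {1}q'E -scalerAl mulrC //.
Qed.

End Separable.

Section SubfieldType.
Variables (L : fieldType) (S : {pred L}) (S_div : divring_closed S).

Let mem_sub : L -> bool := fun x => x \in S.
HB.instance Definition _ := GRing.isDivringClosed.Build L mem_sub S_div.

Record subfield : predArgType :=
  Subfield {subfield_val : L; _ : subfield_val \in mem_sub}.
HB.instance Definition _ := [isSub for subfield_val].
HB.instance Definition _ := [Choice of subfield by <:].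
HB.instance Definition _ := [SubChoice_isSubIntegralDomain of subfield by <:].
HB.instance Definition _ := [SubIntegralDomain_isSubField of subfield by <:].

(** Subfields are sets in the definitions; an actual field with an embedding gives
    access to polynomials with coefficients in the subfield. *)
Lemma subfield_embedding :
  exists (F : fieldType) (iota : {rmorphism F -> L}), range iota = [set` S].
Proof.
exists subfield, (val : {rmorphism subfield -> L}).
apply/seteqP; split => [_ [x _ <-]|x xS]; first exact: (valP x).
by exists (Subfield xS).
Qed.

End SubfieldType.

Section AlgebraicExtension.
Variables (k L : fieldType) (f : {rmorphism k -> L}).
Hypothesis L_sepalg : separably_algebraic f.
Implicit Types (M : set L).

(** Divide an equation of x by a power of x, so that its constant coefficient is
    nonzero. *)
Lemma algebraic_inv (p : {poly k}) x : p != 0 -> root (map_poly f p) x ->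
  exists q : {poly k}, x^-1 = (map_poly f q).[x].
Proof.
have [->|x0] := eqVneq x 0; first by move=> _ _; exists 0; rewrite invr0 rmorph0 horner0.
elim/poly_ind: p => [|p c IHp]; first by rewrite eqxx.
rewrite rmorphD rmorphM /= map_polyX map_polyC /= /root !hornerE.
have [->|c0] := eqVneq c 0.
  rewrite polyC0 !rmorph0 !addr0 !mulf_eq0 (negPf x0) orbF polyX_eq0 orbF.
  exact: IHp.
move=> _; rewrite addr_eq0 => /eqP pxE.
exists (- (c^-1) *: p); rewrite linearZ /= hornerZ.
apply: (mulIf x0); rewrite mulVf // -mulrA pxE rmorphN fmorphV mulrNN mulVf //.
by rewrite fmorph_eq0.
Qed.

Lemma subalgebraV M x : subalgebra f M -> M x -> M x^-1.
Proof.
move=> MS Mx; have [p sp px] := L_sepalg x.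
have [q ->] := algebraic_inv (separable_poly_neq0 sp) px.
rewrite horner_coef; apply: (subalgebra_sum _ _ MS) => i; have [_ _ MM] := MS.
by apply: MM; [rewrite coef_map; exact: subalgebra_base|exact: (subalgebraX _ MS)].
Qed.

Lemma subalgebra_field M : subalgebra f M ->
  exists (F : fieldType) (iota : {rmorphism F -> L}), range iota = M.
Proof.
move=> MS; have [_ MD MM] := MS.
have MS_div : divring_closed (mem M : {pred L}).
  split=> [|x y /set_mem Mx /set_mem My|x y /set_mem Mx /set_mem My]; apply/mem_set.
  - exact: (subalgebra1 MS).
  - by apply: MD => //; exact: (subalgebraN MS).
  - by apply: MM => //; exact: (subalgebraV MS).
have [F [iota iotaE]] := subfield_embedding MS_div; exists F, iota.
by rewrite iotaE; apply/seteqP; split=> x /=; rewrite in_setE.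
Qed.

End AlgebraicExtension.

(** A nonzero annihilating polynomial of least size works: the remainder modulo it
    of any other annihilating polynomial is annihilating and smaller. *)
Lemma minimal_polynomial (F L : fieldType) (iota : {rmorphism F -> L}) (x : L)
    (q0 : {poly F}) :
  q0 != 0 -> root (map_poly iota q0) x ->
  exists2 p : {poly F}, p != 0 & forall q, root (map_poly iota q) x = (p %| q).
Proof.
move=> q00 q0x.
pose P n := `[< exists2 q : {poly F}, q != 0 & root (map_poly iota q) x /\ size q = n >].
have exP : exists n, P n by exists (size q0); apply/asboolP; exists q0.
have [n /asboolP[p p0 [px szp]] minp] := ex_minnP exP.
exists p => // q; apply/idP/idP => [qx|/dvdpP[r ->]]; last first.
  by rewrite rmorphM /= rootM px orbT.
rewrite /dvdp -size_poly_eq0 -leqn0 leqNgt; apply/negP => szr.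
have r0 : q %% p != 0 by rewrite -size_poly_eq0 -lt0n.
suff /minp : P (size (q %% p)) by rewrite leqNgt -szp ltn_modp p0.
apply/asboolP; exists (q %% p) => //; split=> //.
move: qx; rewrite {1}(divp_eq q p) rmorphD rmorphM /root /= hornerD hornerM.
by move/eqP: px => ->; rewrite mulr0 add0r.
Qed.

Section SimpleExtension.
Variables (k L K : fieldType) (f : {rmorphism k -> L}) (j : {rmorphism k -> K}).
Hypothesis L_sepalg : separably_algebraic f.
Hypothesis K_closed : separably_closed K.
Implicit Types (M : set L) (h : L -> K).

Lemma adjoin1_horner M (F : fieldType) (iota : {rmorphism F -> L}) x y :
  subalgebra f M -> range iota = M ->
  adjoin_seq f M [:: x] y <-> exists q : {poly F}, y = (map_poly iota q).[x].
Proof.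
move=> MS iotaM; split=> [|[q ->]]; last first.
  have AS := subalgebra_adjoin_seq f M [:: x].
  rewrite horner_coef; apply: (subalgebra_sum _ _ AS) => i; have [_ _ AM] := AS.
  apply: AM; last by apply: (subalgebraX _ AS); apply: mem_adjoin_seq; rewrite mem_head.
  by rewrite coef_map; apply: sub_adjoin_seq; rewrite -iotaM; eexists.
move: y; apply: adjoin_seq_sub.
- split=> [_ [c _ <-]|_ _ [q ->] [r ->]|_ _ [q ->] [r ->]].
  + have := subalgebra_base c MS; rewrite -iotaM => -[e _ <-].
    by exists e%:P; rewrite map_polyC hornerC.
  + by exists (q + r); rewrite rmorphD hornerD.
  + by exists (q * r); rewrite rmorphM hornerM.
- by move=> y; rewrite -iotaM => -[e _ <-]; exists e%:P; rewrite map_polyC hornerC.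
- move=> y /=; rewrite inE => /eqP ->.
  by exists 'X; rewrite map_polyX hornerX.
Qed.

(** With p the minimal polynomial of x over M, of degree n, the powers of x below
    the n-th form a basis, and a morphism h on M extends to M[x] by sending x to
    any root of h(p). As p divides a separable polynomial, h(p) is separable, and
    it has n distinct roots in the separably closed field K. *)
Lemma simple_extension M x : subalgebra f M ->
  exists n : nat,
    is_basis M (adjoin_seq f M [:: x]) (fun i : 'I_n => x ^+ i) /\
    forall h, hom_on f j M h ->
    exists rs : seq K,
      [/\ uniq rs, size rs = n
        & forall r, r \in rs <-> exists h',
            [/\ hom_on f j (adjoin_seq f M [:: x]) h',
                forall y, M y -> h' y = h y & h' x = r]].
Proof.
move=> MS; have [F [iota iotaM]] := subalgebra_field L_sepalg MS.
have iM e : M (iota e) by rewrite -iotaM; exists e.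
have [p0 sp0 p0x] := L_sepalg x.
(* The separable equation of x over k, seen as a polynomial over M. *)
have [q0 q0E] : exists q0 : {poly F}, map_poly iota q0 = map_poly f p0.
  have cE i : exists e : F, iota e = f p0`_i.
    by have := subalgebra_base p0`_i MS; rewrite -iotaM => -[e _ <-]; exists e.
  have [e eE] := choice cE; exists (\poly_(i < size p0) e i).
  apply/polyP => i; rewrite coef_map coef_poly coef_map /=.
  by case: ltnP => [_|szi]; rewrite ?eE // !rmorph0 nth_default ?rmorph0.
have sq0 : separable_poly q0 by rewrite -(separable_map iota) q0E separable_map.
have [||p pn0 pP] := @minimal_polynomial F L iota x q0.
- exact: separable_poly_neq0.
- by rewrite q0E.
have sp : separable_poly p by apply: dvdp_separable sq0; rewrite -pP q0E.
have szp : size p = (size p).-1.+1 by rewrite prednK // size_poly_gt0.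
have px0 : (map_poly iota p).[x] = 0 by apply/eqP; rewrite -/(root _ _) pP.
exists (size p).-1; split.
  split=> [i|y|c cM c0 i].
  - by apply: (subalgebraX _ (subalgebra_adjoin_seq _ _ _)); apply: mem_adjoin_seq; rewrite mem_head.
  - move/(adjoin1_horner _ _ MS iotaM) => [q ->].
    exists (fun i => iota (q %% p)`_i) => //.
    rewrite {1}(divp_eq q p) rmorphD rmorphM /= hornerD hornerM px0 mulr0 add0r.
    rewrite (@horner_coef_wide _ (size p).-1); last first.
      by rewrite size_map_poly -ltnS -szp ltn_modp.
    by apply: eq_bigr => l _; rewrite coef_map.
  - have cE l : exists e : F, iota e = c l by have := cM l; rewrite -iotaM => -[e _ <-]; exists e.
    have [e eE] := choice cE.
    pose q := \poly_(l < (size p).-1) (if insub l is Some l' then e l' else 0).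
    have qE (l : 'I_(size p).-1) : q`_l = e l.
      by rewrite coef_poly ltn_ord insubT //= => ll; congr (e _); apply: val_inj.
    have /eqP q0' : q == 0.
      have : p %| q.
        rewrite -pP /root (@horner_coef_wide _ (size p).-1) ?size_map_poly ?size_poly //.
        by rewrite -[X in _ == X]c0; apply/eqP/eq_bigr => l _; rewrite coef_map qE /= eE.
      apply: contraLR => q0'; rewrite gtNdvdp // szp ltnS size_poly //.
    by rewrite -eE -qE q0' coef0 rmorph0.
move=> h hM.
have [hj hD hMul] := hM.
have M0 : M 0 by exact: subalgebra0 MS.
have M1 : M 1 by exact: subalgebra1 MS.
pose g0 := h \o iota.
have g0D : zmod_morphism g0.
  move=> a b; apply: (@addIr _ (g0 b)); rewrite subrK /g0 /= -hD ?iM //.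
  by rewrite -rmorphD subrK.
have g0M : monoid_morphism g0.
  split; first by rewrite /g0 /= rmorph1 -(rmorph1 f) hj rmorph1.
  by move=> a b; rewrite /g0 /= rmorphM hMul.
pose G := GRing.isMonoidMorphism.Build _ _ g0 g0M.
pose G' := GRing.isZmodMorphism.Build _ _ g0 g0D.
pose g : {rmorphism F -> K} := HB.pack g0 G G'.
have hg e : h (iota e) = g e by [].
have [|rs [urs srs pE]] := @separably_closed_split K (map_poly g p) K_closed.
  by rewrite separable_map.
have rootP r : (r \in rs) = root (map_poly g p) r.
  rewrite pE rootZ ?root_prod_XsubC // lead_coef_eq0 map_poly_eq0 //.
exists rs; split=> //; first by rewrite srs size_map_poly.
move=> r; split=> [|[h' [h'M h'h h'x]]]; last first.
  rewrite rootP /root -h'x.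
  have [||||_ <-] := @hom_on_horner _ _ _ f j (adjoin_seq f M [:: x]) h' F iota g x p _ h'M.
  + exact: subalgebra_adjoin_seq.
  + by move=> e; apply: sub_adjoin_seq.
  + by move=> e; rewrite h'h.
  + by apply: mem_adjoin_seq; rewrite mem_head.
  have h'0 : h' 0 = 0 by rewrite h'h // -(rmorph0 f) hj rmorph0.
  by rewrite px0 h'0.
rewrite rootP => pr.
(* An element q(x) of M[x] is sent to g(q)(r), which does not depend on the choice
   of q since two choices differ by a multiple of p. *)
pose h' y := (map_poly g (xget 0 [set q | y = (map_poly iota q).[x]])).[r].
have h'E q : h' (map_poly iota q).[x] = (map_poly g q).[r].
  rewrite /h'; set q' := xget _ _.
  have q'E : (map_poly iota q).[x] = (map_poly iota q').[x].
    by apply: (@xgetPex _ 0 [set q' | (map_poly iota q).[x] = (map_poly iota q').[x]]); exists q.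
  have : p %| q' - q by rewrite -pP /root rmorphB hornerD hornerN q'E subrr.
  case/dvdpP => d /(canRL (subrK _)) ->.
  by rewrite rmorphD rmorphM /= hornerD hornerM; move/eqP: pr => ->; rewrite mulr0 add0r.
have h'iota e : h' (iota e) = g e.
  by have := h'E e%:P; rewrite !map_polyC !hornerC.
exists h'; split.
- split=> [c|y z|y z].
  + have := subalgebra_base c MS; rewrite -iotaM => -[e _ eE].
    by rewrite -eE h'iota -hg eE hj.
  + move=> /(adjoin1_horner _ _ MS iotaM) [q ->] /(adjoin1_horner _ _ MS iotaM) [q' ->].
    by rewrite -hornerD -rmorphD !h'E rmorphD hornerD.
  + move=> /(adjoin1_horner _ _ MS iotaM) [q ->] /(adjoin1_horner _ _ MS iotaM) [q' ->].
    by rewrite -hornerM -rmorphM !h'E rmorphM hornerM.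
- by move=> y; rewrite -iotaM => -[e _ <-]; rewrite h'iota.
- by have := h'E 'X; rewrite !map_polyX !hornerX.
Qed.

End SimpleExtension.

(** * Degrees and finite extensions *)
Section Degree.
Variables (k L : fieldType) (f : {rmorphism k -> L}).
Implicit Types (E F G : set L).

(** Let P express the basis b in terms of the spanning family s, and Q express s in
    terms of b. Then b = PQb, and PQ has its entries in E, so that PQ = 1 by
    freeness of b; as L is commutative, this forces m <= n. *)
Lemma basis_size_le E F m n (b : 'I_m -> L) (s : 'I_n -> L) :
  subalgebra f E -> is_basis E F b -> (forall i, F (s i)) ->
  (forall x, F x -> exists2 c : 'I_n -> L,
     (forall i, E (c i)) & x = \sum_(i < n) c i * s i) ->
  (m <= n)%N.
Proof.
move=> ES [Fb b_span b_free] Fs s_span; have [_ ED EM] := ES.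
have /choice[P PE] i : exists c : 'I_n -> L,
    (forall l, E (c l)) /\ b i = \sum_(l < n) c l * s l.
  by have [c] := s_span _ (Fb i); exists c.
have /choice[Q QE] l : exists c : 'I_m -> L,
    (forall i, E (c i)) /\ s l = \sum_(i < m) c i * b i.
  by have [c] := b_span _ (Fs l); exists c.
apply: (@mulmx1_min _ _ _ (\matrix_(i, l) P i l) (\matrix_(l, i) Q l i)).
apply/matrixP => i i'; rewrite !mxE; apply/eqP; rewrite -subr_eq0; apply/eqP.
apply: (b_free (fun i' => \sum_l (\matrix_(i, l) P i l) i l * (\matrix_(l, i) Q l i) l i'
          - (i == i')%:R)) => [i0|].
  apply: ED; last first.
    by apply: (subalgebraN ES); case: (i == i0); [exact: (subalgebra1 ES)|exact: (subalgebra0 ES)].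
  by apply: (subalgebra_sum _ _ ES) => l; rewrite !mxE; apply: EM; [case: (PE i)|case: (QE l)].
under eq_bigr do rewrite mulrBl mulr_suml.
rewrite big_split /= sumrN exchange_big /=.
apply/eqP; rewrite subr_eq0; apply/eqP.
transitivity (b i).
  rewrite (PE i).2; apply: eq_bigr => l _; rewrite (QE l).2 mulr_sumr.
  by apply: eq_bigr => i0 _; rewrite !mxE mulrA.
rewrite (bigD1 i) //= eqxx mul1r big1 ?addr0 // => i0 /negPf i0i.
by rewrite eq_sym i0i mul0r.
Qed.

Lemma ext_degree_basis E F n (b : 'I_n -> L) :
  subalgebra f E -> is_basis E F b -> ext_degree E F = n.
Proof.
move=> ES bB; apply: xget_unique; first by exists b.
move=> m [b' b'B]; apply/eqP; rewrite eqn_leq.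
have [Fb b_span _] := bB; have [Fb' b'_span _] := b'B.
by rewrite (basis_size_le ES bB Fb' b'_span) (basis_size_le ES b'B Fb b_span).
Qed.

Lemma tower_basis E F G m n (b : 'I_m -> L) (c : 'I_n -> L) :
  subalgebra f E -> subalgebra f F -> subalgebra f G ->
  E `<=` F -> F `<=` G -> is_basis E F b -> is_basis F G c ->
  exists d : 'I_(m * n)%N -> L, is_basis E G d.
Proof.
move=> ES FS GS EF FG [Fb b_span b_free] [Gc c_span c_free].
have [_ FD FM] := FS; have [_ GD GM] := GS.
have -> : (m * n)%N = #|{: 'I_m * 'I_n}| by rewrite card_prod !card_ord.
exists (fun i => b (enum_val i).1 * c (enum_val i).2); split.
- by move=> i; apply: GM => //; apply: FG.
- move=> x /c_span [e eF ->].
  have /choice[a aE] l : exists a : 'I_m -> L,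
      (forall i, E (a i)) /\ e l = \sum_(i < m) a i * b i.
    by have [a] := b_span _ (eF l); exists a.
  exists (fun i => a (enum_val i).2 (enum_val i).1) => [i|]; first by case: (aE (enum_val i).2).
  rewrite -(@reindex _ _ _ _ _ enum_val xpredT (fun p => a p.2 p.1 * (b p.1 * c p.2))) /=; last first.
    exact/onW_bij/enum_val_bij.
  rewrite -(pair_bigA _ (fun i l => a l i * (b i * c l))) /= exchange_big /=.
  apply: eq_bigr => l _; rewrite (aE l).2 mulr_suml.
  by apply: eq_bigr => i _; rewrite mulrA.
- move=> a aE a0 i.
  pose a' p := a (enum_rank p).
  have a'0 p : a' p = 0.
    rewrite (surjective_pairing p); move: p.1 p.2 => {p}.
    suff a'0 l i0 : a' (i0, l) = 0 by move=> i0 l.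
    apply: (b_free (fun i0 => a' (i0, l))) => [i1|]; first exact: aE.
    apply: (c_free (fun l => \sum_i0 a' (i0, l) * b i0)) => [l0|].
      by apply: (subalgebra_sum _ _ FS) => i1; apply: FM => //; apply: EF; exact: aE.
    rewrite -[RHS]a0.
    rewrite (@reindex _ _ _ _ _ enum_rank xpredT) /=; last first.
      exact/onW_bij/enum_rank_bij.
    rewrite [RHS](eq_bigr (fun p => a' (p.1, p.2) * (b p.1 * c p.2))); last first.
      by move=> [i1 l1] _; rewrite enum_rankK.
    rewrite -(pair_bigA _ (fun i l => a' (i, l) * (b i * c l))) /= exchange_big /=.
    apply: eq_bigr => l0 _; rewrite mulr_suml.
    by apply: eq_bigr => i1 _; rewrite mulrA.
  by rewrite -(enum_valK i) -/(a' _).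
Qed.

End Degree.

Section FiniteExtension.
Variables (k L K : fieldType) (f : {rmorphism k -> L}) (j : {rmorphism k -> K}).
Hypothesis L_sepalg : separably_algebraic f.
Hypothesis K_closed : separably_closed K.
Implicit Types (M : set L) (h : L -> K).

(** Degrees and fibres of the restriction maps of morphisms are multiplicative in
    towers, so both are computed by adjoining the entries of t one by one. A
    morphism on M[t] that extends h is recorded by its values on t, which makes
    the fibre over h a list of tuples. *)
Lemma finite_extension M (t : seq L) : subalgebra f M ->
  exists n : nat,
    (exists b : 'I_n -> L, is_basis M (adjoin_seq f M t) b) /\
    forall h, hom_on f j M h ->
    exists vs : seq (seq K),
      [/\ uniq vs, size vs = n
        & forall v, v \in vs <-> exists h',
            [/\ hom_on f j (adjoin_seq f M t) h',
                forall y, M y -> h' y = h y & map h' t = v]].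
Proof.
elim: t M => [|x t IHt] M MS.
  exists 1%N; split.
    exists (fun _ => 1); rewrite adjoin_seq_nil //; split=> [i|y My|c cM].
    + exact: subalgebra1 MS.
    + by exists (fun _ => y) => //; rewrite big_ord1 mulr1.
    + by rewrite big_ord1 mulr1 => c0 i; rewrite ord1.
  move=> h hM; exists [:: [::]]; split=> // v; rewrite inE adjoin_seq_nil //.
  by split=> [/eqP -> |[h' [_ _ <-]]//]; exists h.
have [n1 [b1 step1]] := simple_extension j L_sepalg K_closed x MS.
set M1 := adjoin_seq f M [:: x] in b1 step1.
have M1S : subalgebra f M1 by exact: subalgebra_adjoin_seq.
have [n2 [[b2 b2B] step2]] := IHt M1 M1S.
rewrite adjoin_seq_cons -/M1; exists (n1 * n2)%N; split.
  apply: (tower_basis MS M1S (subalgebra_adjoin_seq f M1 t) _ _ b1 b2B);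
    exact: sub_adjoin_seq.
move=> h hM; have [rs [urs srs rsP]] := step1 h hM.
have /choice[vs vsP] r : exists vs : seq (seq K), r \in rs ->
    [/\ uniq vs, size vs = n2
      & forall v, v \in vs <-> exists h',
          [/\ hom_on f j (adjoin_seq f M1 t) h',
              forall y, M y -> h' y = h y, h' x = r & map h' t = v]].
  have [/rsP[h1 [h1M1 h1h h1x]]|] := boolP (r \in rs); last by exists [::].
  have [vs [uvs svs vsP]] := step2 h1 h1M1; exists vs => _; split=> // v.
  rewrite vsP; split=> [[h' [h'M h'h1 h'v]]|[h' [h'M h'h h'x h'v]]]; exists h'; split=> //.
  + by move=> y My; rewrite h'h1 ?h1h //; exact: sub_adjoin_seq.
  + by rewrite h'h1 //; apply: mem_adjoin_seq; rewrite mem_head.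
  + apply: (@hom_on_eq_gen _ _ _ f j (M `|` [set` [:: x]])) => //.
      by apply: hom_on_sub h'M; exact: sub_adjoin_seq.
    by move=> y [My|/=]; [rewrite h'h ?h1h|rewrite inE => /eqP ->; rewrite h'x h1x].
exists [seq r :: v | r <- rs, v <- vs r]; split.
- apply: allpairs_uniq_dep => //; first by move=> r /vsP[].
  by case=> [r v] [r' v'] _ _ /= [-> ->].
- rewrite size_allpairs_dep -srs.
  have : {in rs, forall r, size (vs r) = n2} by move=> r /vsP[].
  elim: (rs) => [|r rs' IH] H //=; rewrite H ?mem_head // IH ?mulSn // => r' r'rs.
  by apply: H; rewrite inE r'rs orbT.
- move=> v; split=> [/allpairsPdep[r [v' [rrs v'vs ->]]]|[h' [h'M h'h <-]]].
    have [_ _ /(_ v')[/(_ v'vs)[h' [? ? <- <-]] _]] := vsP r rrs.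
    by exists h'; split.
  have h'rs : h' x \in rs.
    apply/rsP; exists h'; split=> //.
    by apply: hom_on_sub h'M; exact: sub_adjoin_seq.
  apply/allpairsPdep; exists (h' x), (map h' t); split=> //.
  by have [_ _ ->] := vsP _ h'rs; exists h'.
Qed.

(** A degree is positive, hence so is the number of extensions. *)
Lemma hom_extends M t h : subalgebra f M -> hom_on f j M h ->
  exists2 h', hom_on f j (adjoin_seq f M t) h' & forall y, M y -> h' y = h y.
Proof.
move=> MS hM; have [n [[b [_ b_span _]] /(_ h hM)[vs [_ svs vsP]]]] := finite_extension t MS.
have [vs0|] := eqVneq vs [::].
  have n0 : n = 0%N by rewrite -svs vs0.
  rewrite {}n0 in b b_span.
  have [|c _ /eqP] := b_span 1; first exact: subalgebra1 (subalgebra_adjoin_seq _ _ _).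
  by rewrite big_ord0 oner_eq0.
by case: vs svs vsP => // v vs _ /(_ v)[/(_ (mem_head _ _))[h' []]]; exists h'.
Qed.

End FiniteExtension.

(** * The stages k[a, ..., sigma^(l-1)(a)] *)
Section Stages.
Variables (k L : fieldType) (f : {rmorphism k -> L}) (sL : {rmorphism L -> L}).
Variable a : seq L.

(** The stage l is [sigma_gen_upto] at l - 1; the shift by one makes the stage 0 the
    base field, and the stage l the one that the first l letters of an itinerary
    control. *)
Definition stage (l : nat) : set L := smallest (subalgebra f)
  [set y | exists2 x, x \in a & exists2 m, (m < l)%N & y = iter m sL x].

Lemma subalgebra_stage l : subalgebra f (stage l).
Proof. exact: subalgebra_smallest. Qed.

Lemma mem_stage l m x : x \in a -> (m < l)%N -> stage l (iter m sL x).
Proof. by move=> ax ml; apply: sub_gen_smallest; exists x => //; exists m. Qed.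

Lemma stage0 : stage 0 = range f.
Proof.
apply/seteqP; split=> [|x [c _ <-]].
  apply: smallest_sub => [|x [y _ [m]]]; last by rewrite ltn0.
  split=> [//|_ _ [c _ <-] [c' _ <-]|_ _ [c _ <-] [c' _ <-]].
  - by exists (c + c') => //; rewrite rmorphD.
  - by exists (c * c') => //; rewrite rmorphM.
exact: subalgebra_base (subalgebra_stage 0).
Qed.

Lemma stageS l : stage l.+1 = adjoin_seq f (stage l) [seq iter l sL x | x <- a].
Proof.
rewrite -smallest_adjoin_seq; congr smallest; apply/seteqP; split.
  move=> _ [x ax [m + ->]]; rewrite ltnS leq_eqVlt => /orP[/eqP ->|ml].
    by right; apply/mapP; exists x.
  by left; exists x => //; exists m.
move=> y [[x ax [m ml ->]]|/= /mapP[x ax ->]]; exists x => //.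
  by exists m => //; exact: ltnW.
by exists l.
Qed.

Lemma stage_mono l m : (l <= m)%N -> stage l `<=` stage m.
Proof.
move=> lm; apply: smallest_sub; first exact: subalgebra_stage.
by move=> _ [x ax [i il ->]]; apply: mem_stage => //; exact: leq_trans lm.
Qed.

Lemma stage_exhausts : sigma_gen f sL a = setT -> forall y, exists l, stage l y.
Proof.
move=> gen y; have : sigma_gen f sL a y by rewrite gen.
move: y; apply: smallest_sub => [|_ [x ax [m ->]]]; last first.
  by exists m.+1; exact: mem_stage.
split=> [_ [c _ <-]|x y [l lx] [m my]|x y [l lx] [m my]].
- by exists 0%N; exact: subalgebra_base (subalgebra_stage 0).
- exists (maxn l m); have [_ + _] := subalgebra_stage (maxn l m); apply.
  + by apply: stage_mono lx; exact: leq_maxl.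
  + by apply: stage_mono my; exact: leq_maxr.
- exists (maxn l m); have [_ _] := subalgebra_stage (maxn l m); apply.
  + by apply: stage_mono lx; exact: leq_maxl.
  + by apply: stage_mono my; exact: leq_maxr.
Qed.

Lemma stage_shift (sk : {rmorphism k -> k}) l x :
  diff_morphism sk sL f -> stage l x -> stage l.+1 (sL x).
Proof.
move=> f_diff; move: x; apply: smallest_sub; last first.
  by move=> _ [x ax [m ml ->]]; rewrite /= -iterS; exact: mem_stage.
have [_ SD SM] := subalgebra_stage l.+1.
split=> [_ [c _ <-]|x y /= Sx Sy|x y /= Sx Sy] /=.
- by rewrite -f_diff; exact: subalgebra_base (subalgebra_stage _).
- by rewrite rmorphD; exact: SD.
- by rewrite rmorphM; exact: SM.
Qed.

Definition stage_degree l := ext_degree (stage l) (stage l.+1).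

End Stages.

Section StageHoms.
Variables (k L K : fieldType) (f : {rmorphism k -> L}) (j : {rmorphism k -> K}).
Variables (sk : {rmorphism k -> k}) (sL : {rmorphism L -> L}).
Hypothesis f_diff : diff_morphism sk sL f.
Hypothesis L_sepalg : separably_algebraic f.
Hypothesis K_closed : separably_closed K.
Variable a : seq L.
Hypothesis a_gen : sigma_gen f sL a = setT.

Local Notation stage := (stage f sL a).
Local Notation deg := (stage_degree f sL a).

Lemma stage_basis l : exists b : 'I_(deg l) -> L, is_basis (stage l) (stage l.+1) b.
Proof.
have lS := subalgebra_stage f sL a l.
have [n [[b +] _]] := finite_extension j L_sepalg K_closed [seq iter l sL x | x <- a] lS.
rewrite -stageS => bB; suff -> : deg l = n by exists b.
exact: (ext_degree_basis lS bB).
Qed.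

(** If b spans the stage l + 1 over the stage l, then sigma(b) spans the stage l + 2
    over the stage l + 1: its span T contains the image of the stage l + 1 under
    sigma, hence 1, the stage l + 1 and the new generators, and it is closed under
    products, as those of two entries of sigma(b) are images of elements of the
    stage l + 1. *)
Lemma stage_degree_noninc l : (deg l.+1 <= deg l)%N.
Proof.
have [b bB] := stage_basis l; have [b' b'B] := stage_basis l.+1.
have [stage_b b_span _] := bB.
have lS := subalgebra_stage f sL a l; have [_ LD LM] := lS.
have l1S := subalgebra_stage f sL a l.+1; have [_ SD SM] := l1S.
apply: (basis_size_le l1S b'B (s := sL \o b)) => [i|].
  exact: (stage_shift f_diff).
set T := (X in forall x, _ -> X x).
have TD x y : T x -> T y -> T (x + y).
  move=> [c cS ->] [c' c'S ->]; exists (fun i => c i + c' i) => [i|]; first exact: SD.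
  by rewrite -big_split; apply: eq_bigr => i _; rewrite mulrDl.
have T_scale x y : stage l.+1 x -> T y -> T (x * y).
  move=> Sx [c cS ->]; exists (fun i => x * c i) => [i|]; first exact: SM.
  by rewrite mulr_sumr; apply: eq_bigr => i _; rewrite mulrA.
have T_sum (F : 'I_(deg l) -> L) : (forall i, T (F i)) -> T (\sum_i F i).
  move=> TF; elim/big_ind: _ => //.
  exists (fun=> 0) => [i|]; first exact: subalgebra0 l1S.
  by rewrite big1 // => i _; rewrite mul0r.
have T_sL x : stage l.+1 x -> T (sL x).
  move=> /b_span[c cS ->]; exists (sL \o c) => [i|]; first exact: (stage_shift f_diff).
  by rewrite rmorph_sum; apply: eq_bigr => i _; rewrite rmorphM.
have T_stage x : stage l.+1 x -> T x.
  move=> Sx; rewrite -(mulr1 x); apply: T_scale => //.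
  by rewrite -(rmorph1 sL); apply: T_sL; exact: subalgebra1 l1S.
apply: smallest_sub => [|_ [x ax [[|m] ml ->]]].
- split=> [_ [c _ <-]|//|x y [c cS ->] Ty].
    by apply: T_stage; exact: subalgebra_base l1S.
  rewrite mulr_suml; apply/T_sum => i; rewrite -mulrA; apply/T_scale => //.
  have [c' c'S ->] := Ty; rewrite mulr_sumr; apply/T_sum => i'.
  rewrite mulrCA; apply/T_scale => //; rewrite /= -rmorphM; apply: T_sL.
  exact: SM.
- by apply: T_stage; exact: mem_stage.
- by rewrite iterS; apply: T_sL; exact: mem_stage.
Qed.

Lemma stage_degree_ultimately :
  exists l0, forall l, (l0 <= l)%N -> deg l = deg l0.
Proof.
pose P n := `[< exists l, deg l = n >].
have exP : exists n, P n by exists (deg 0); apply/asboolP; exists 0%N.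
have [_ /asboolP[l0 <-] min0] := ex_minnP exP.
exists l0 => l /subnK <-; apply/eqP; rewrite eqn_leq; apply/andP; split.
  elim: (l - l0)%N => // n IHn; rewrite addSn.
  exact: leq_trans (stage_degree_noninc _) IHn.
by apply: min0; apply/asboolP; eexists.
Qed.

(** The value at y is the common value of the h_ n for all n such that y is in M n;
    any two elements, with their sum and product, lie in a common M n. *)
Lemma hom_glue (M : nat -> set L) (h_ : nat -> L -> K) :
  (forall n, M n `<=` M n.+1) -> (forall y, exists n, M n y) ->
  (forall n, hom_on f j (M n) (h_ n)) ->
  (forall n y, M n y -> h_ n.+1 y = h_ n y) ->
  exists2 h, hom_on f j setT h & forall n y, M n y -> h y = h_ n y.
Proof.
move=> Mmono /choice[e Me] h_M h_eq.
have Mle m n : (m <= n)%N -> M m `<=` M n.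
  by move=> /subnK <-; elim: (n - m)%N => // i IHi y /IHi; rewrite addSn; apply: Mmono.
have hle m n y : (m <= n)%N -> M m y -> h_ n y = h_ m y.
  move=> /subnK <- My; elim: (n - m)%N => // i IHi.
  by rewrite addSn h_eq //; apply: Mle My; exact: leq_addl.
pose h y := h_ (e y) y.
have hE n y : M n y -> h y = h_ n y.
  move=> My; transitivity (h_ (maxn n (e y)) y).
    by apply/esym/hle => //; exact: leq_maxr.
  by apply: hle => //; exact: leq_maxl.
exists h => //; split=> [c|x y _ _|x y _ _].
- by have [hj _ _] := h_M (e (f c)); rewrite /h hj.
- pose n := maxn (maxn (e x) (e y)) (e (x + y)).
  have [Mx My Mxy] : [/\ M n x, M n y & M n (x + y)].
    by split; apply: Mle (Me _); rewrite /n !leq_max leqnn ?orbT.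
  by have [_ hD _] := h_M n; rewrite !(hE n) ?hD.
- pose n := maxn (maxn (e x) (e y)) (e (x * y)).
  have [Mx My Mxy] : [/\ M n x, M n y & M n (x * y)].
    by split; apply: Mle (Me _); rewrite /n !leq_max leqnn ?orbT.
  by have [_ _ hM] := h_M n; rewrite !(hE n) ?hM.
Qed.

Lemma stage_hom_extends l h : hom_on f j (stage l) h ->
  exists2 h', hom_on f j setT h' & forall y, stage l y -> h' y = h y.
Proof.
move=> hM.
have /choice[E EP] (p : nat * (L -> K)) : exists h', hom_on f j (stage p.1) p.2 ->
    hom_on f j (stage p.1.+1) h' /\ forall y, stage p.1 y -> h' y = p.2 y.
  have [pM|] := pselect (hom_on f j (stage p.1) p.2); last by exists p.2.
  have [h' h'M h'E] := hom_extends L_sepalg K_closed [seq iter p.1 sL x | x <- a]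
    (subalgebra_stage f sL a p.1) pM.
  by exists h' => _; split=> //; rewrite stageS.
pose h_ n := iteri n (fun i g => E (l + i, g)%N) h.
have h_M n : hom_on f j (stage (l + n)) (h_ n).
  elim: n => [|n /(EP (_, _)) [h_M _]]; first by rewrite addn0.
  by rewrite addnS.
have [|y|n y|h' h'M h'E] := hom_glue (M := fun n => stage (l + n)) _ _ h_M.
- by move=> n; apply: stage_mono; rewrite addnS.
- have [n ny] := stage_exhausts a_gen y; exists n.
  by apply: stage_mono ny; exact: leq_addl.
- by case: (EP (_, _) (h_M n)) => _; apply.
by exists h' => // y ly; rewrite (h'E 0%N) // addn0.
Qed.

Lemma eq_on_stage l h h' : hom_on f j (stage l) h -> hom_on f j (stage l) h' ->
  (forall i, (i < l)%N -> {in a, forall x, h (iter i sL x) = h' (iter i sL x)}) ->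
  forall y, stage l y -> h y = h' y.
Proof.
move=> hM h'M hh'; apply: hom_on_eq_gen hM h'M _ => _ [x ax [m ml ->]].
exact: hh'.
Qed.

(** The values on the generators of the stage l, grouped by power of sigma: one
    tuple for each letter of an itinerary. *)
Definition stage_values (h : L -> K) l : seq (seq K) :=
  mkseq (fun i => [seq h (iter i sL x) | x <- a]) l.

Lemma eq_stage_values l h h' : hom_on f j (stage l) h -> hom_on f j (stage l) h' ->
  stage_values h l = stage_values h' l <-> forall y, stage l y -> h y = h' y.
Proof.
move=> hM h'M; split=> [/eq_in_map hh'|hh'].
  apply: eq_on_stage => // i il; apply/eq_in_map.
  by apply: hh'; rewrite mem_iota.
apply/eq_in_map => i; rewrite mem_iota add0n => /andP[_ il].
by apply/eq_in_map => x ax; apply: hh'; exact: mem_stage.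
Qed.

(** A morphism on a stage is known from its values on the generators, so listing
    these values amounts to listing the morphisms. *)
Lemma stage_values_enum l : exists vs : seq (seq (seq K)),
  [/\ uniq vs, size vs = (\prod_(i < l) deg i)%N
    & forall v, v \in vs <-> exists2 h, hom_on f j (stage l) h & stage_values h l = v].
Proof.
elim: l => [|l [vs [uvs svs vsP]]].
  exists [:: [::]]; rewrite big_ord0; split=> // v; rewrite inE.
  split=> [/eqP ->|[h _ <-] //]; rewrite stage0.
  pose h0 y := j (xget 0 [set c | f c = y]); exists h0 => //.
  have jE c : h0 (f c) = j c.
    rewrite /h0; congr (j _); apply: (fmorph_inj f).
    by apply: (@xgetPex _ 0 [set c' | f c' = f c]); exists c.
  split=> // _ _ [c _ <-] [c' _ <-].
  - by rewrite -rmorphD !jE rmorphD.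
  - by rewrite -rmorphM !jE rmorphM.
have lS := subalgebra_stage f sL a l.
have [n [[b bB] ext]] := finite_extension j L_sepalg K_closed [seq iter l sL x | x <- a] lS.
rewrite -stageS in bB ext.
have degE : deg l = n := ext_degree_basis lS bB.
(* The possible values on the next power of sigma depend only on the previous
   values v, and not on the morphism that is chosen to realize them. *)
have /choice[ws wsP] v : exists ws : seq (seq K), v \in vs ->
    [/\ uniq ws, size ws = n & forall w, w \in ws <-> exists h',
      [/\ hom_on f j (stage l.+1) h', stage_values h' l = v
        & [seq h' y | y <- [seq iter l sL x | x <- a]] = w]].
  have [/vsP[h hM hv]|] := boolP (v \in vs); last by exists [::].
  have [ws [uws sws wsP]] := ext h hM; exists ws => _; split=> // w; rewrite wsP.
  split=> -[h' [h'M h'h h'w]]; exists h'; split=> //.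
    by rewrite -hv eq_stage_values //; apply: hom_on_sub h'M; exact: stage_mono.
  apply/eq_stage_values => //; last by rewrite hv.
  by apply: hom_on_sub h'M; exact: stage_mono.
exists [seq rcons v w | v <- vs, w <- ws v]; split.
- apply: allpairs_uniq_dep => //; first by move=> v /wsP[].
  by case=> [v w] [v' w'] _ _ /= /rcons_inj [-> ->].
- rewrite size_allpairs_dep big_ord_recr /= degE -svs.
  have : {in vs, forall v, size (ws v) = n} by move=> v /wsP[].
  elim: (vs) => [|v vs' IH] H //=; rewrite H ?mem_head // IH ?mulSn // => v' v'vs.
  by apply: H; rewrite inE v'vs orbT.
- have valuesS h : stage_values h l.+1 =
      rcons (stage_values h l) [seq h y | y <- [seq iter l sL x | x <- a]].
    by rewrite /stage_values mkseqS -map_comp.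
  move=> v; split=> [/allpairsPdep[v' [w [v'vs wws ->]]]|[h hM <-]].
    have [_ _ /(_ w)[/(_ wws)[h [hM <- <-]] _]] := wsP _ v'vs.
    by exists h.
  have hvs : stage_values h l \in vs.
    by apply/vsP; exists h => //; apply: hom_on_sub hM; exact: stage_mono.
  rewrite valuesS; apply/allpairsPdep; do 2!eexists; split; [exact: hvs| |by []].
  by have [_ _ ->] := wsP _ hvs; exists h.
Qed.

End StageHoms.

(** * The self-map of the space of points *)
Section Twist.
Variables (k L K : fieldType) (f : {rmorphism k -> L}) (j : {rmorphism k -> K}).
Variables (sk : {rmorphism k -> k}) (sL : {rmorphism L -> L}) (sK : {rmorphism K -> K}).
Hypothesis f_diff : diff_morphism sk sL f.
Hypothesis j_diff : diff_morphism sk sK j.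
Hypothesis L_sepalg : separably_algebraic f.
Hypothesis K_closed : separably_closed K.

(** An element x of L is a root of a separable polynomial p over k, so h (sigma x) is
    a root of the image of j(p) under the endomorphism of K. As j(p) splits in K,
    the roots of that image are the images of the roots of j(p); hence h \o sigma
    factors through the endomorphism of K, which is injective. *)
Lemma twist_exists h : hom_on f j setT h ->
  exists2 h', hom_on f j setT h' & forall x, sK (h' x) = h (sL x).
Proof.
move=> hT; have [hj hD hM] := hT.
have /choice[h' h'E] x : exists z, sK z = h (sL x).
  have [p sp /eqP px] := L_sepalg x.
  have spj : separable_poly (map_poly j p) by rewrite separable_map.
  have [rs [_ _ pE]] := separably_closed_split K_closed spj.
  have [|||| _] := @hom_on_horner _ _ _ f j setT h k (f \o sk) (j \o sk) (sL x) p _ hT => //=.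
  have -> : (map_poly (f \o sk) p).[sL x] = 0.
    have -> : map_poly (f \o sk) p = map_poly (sL \o f) p.
      by apply: eq_map_poly => c /=; rewrite f_diff.
    by rewrite map_poly_comp horner_map px rmorph0.
  have -> : h 0 = 0 by rewrite -(rmorph0 f) hj rmorph0.
  have -> : map_poly (j \o sk) p = map_poly (sK \o j) p.
    by apply: eq_map_poly => c /=; rewrite j_diff.
  move=> /esym/eqP; rewrite -/(root _ _) map_poly_comp pE map_polyZ rootZ; last first.
    by rewrite fmorph_eq0 lead_coef_eq0 separable_poly_neq0.
  rewrite rmorph_prod /=.
  under eq_bigr do rewrite map_polyXsubC.
  rewrite -(big_map sK xpredT (fun r => 'X - r%:P)) root_prod_XsubC => /mapP[r _ ->].
  by exists r.
exists h' => //; split=> [c|x y _ _|x y _ _]; apply: (fmorph_inj sK).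
- by rewrite h'E -f_diff hj j_diff.
- by rewrite rmorphD !h'E rmorphD hD.
- by rewrite rmorphM !h'E rmorphM hM.
Qed.

Implicit Types h : points f j.

Lemma points_hom h : hom_on f j setT (set_val h).
Proof. by apply/hom_onTP; exact: (set_mem (valP h)). Qed.

Lemma hom_point (g : L -> K) : hom_on f j setT g -> exists h, set_val h = g.
Proof. by move=> /hom_onTP/mem_set gP; exists (exist _ g gP). Qed.

Lemma points_inj h h' : (forall x, set_val h x = set_val h' x) -> h = h'.
Proof. by move=> hh'; apply: val_inj; apply/funext. Qed.

Local Notation twist := (@twist k L K f j sL sK).

(** The existence of the twist gives access to the defining property of its [xget]. *)
Lemma twistE h x : sK (set_val (twist h) x) = set_val h (sL x).
Proof.
have [g gT gE] := twist_exists (points_hom h).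
have [h' h'g] := hom_point gT.
move: x; apply: (@xgetPex _ h
  [set h' : points f j | forall x, sK (set_val h' x) = set_val h (sL x)]).
by exists h' => x; rewrite h'g gE.
Qed.

Lemma iter_twistE h i x : iter i sK (set_val (iter i twist h) x) = set_val h (iter i sL x).
Proof.
elim: i x => //= i IHi x.
by rewrite -iterS iterSr twistE IHi -iterSr.
Qed.

End Twist.

(** * Topology of shift spaces *)
Section Topology.

Lemma initial_nbhsP (S : choiceType) (T : topologicalType) (g : S -> T)
    (x : initial_topology g) (A : set (initial_topology g)) :
  nbhs x A <-> exists2 B, nbhs (g x) B & g @^-1` B `<=` A.
Proof.
split=> [|[B gxB BA]]; last by apply: filterS BA _; exact: (@initial_continuous _ _ g x).
rewrite nbhsE => -[_ [[B oB <-] Bgx] BA]; exists B => //.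
by exists B.
Qed.

Lemma discrete_nbhsP (T : choiceType) (x : discrete_topology T)
    (A : set (discrete_topology T)) : nbhs x A <-> A x.
Proof.
by rewrite nbhs_principalE; split=> /principal_filterP.
Qed.

Lemma prod_cvgP (I : Type) (T : I -> topologicalType) (F : set_system (prod_topology T))
    (x : prod_topology T) : Filter F ->
  F --> x <-> forall i (B : set (T i)), nbhs (x i) B -> F [set y | B (y i)].
Proof.
move=> FF; split=> [/cvg_sup Fx i B xB|Fx].
  by apply: (Fx i); apply/(@initial_nbhsP _ _ (fun y : prod_topology T => y i)); exists B.
apply/cvg_sup => i A /(@initial_nbhsP _ _ (fun y : prod_topology T => y i)) [B xB BA].
by apply: filterS BA _; exact: Fx.
Qed.

Lemma prod_nbhs_coord (I : Type) (T : I -> topologicalType) (x : prod_topology T)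
    (i : I) (B : set (T i)) : nbhs (x i) B -> nbhs x [set y | B (y i)].
Proof. exact: ((prod_cvgP x (nbhs_filter x)).1 cvg_id). Qed.

Lemma full_shift_nbhsP (E0 : finType) (x : full_shift E0) (A : set (full_shift E0)) :
  nbhs x A <-> exists m, forall y : full_shift E0,
    (forall i, (i < m)%N -> y i = x i) -> A y.
Proof.
split=> [|[m mA]]; last first.
  have : nbhs x [set y : full_shift E0 | forall i, (i < m)%N -> y i = x i].
    elim: m {mA} => [|m IHm]; first by apply: filterS filterT.
    have xm := @prod_nbhs_coord nat _ x m [set x m] (discrete_set1 (x m)).
    move: IHm xm; apply: filterS2 => y /= ym yxm i; rewrite ltnS leq_eqVlt => /orP[/eqP -> //|].
    exact: ym.
  exact: filterS.
pose F := filter_from setT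
  (fun m => [set y : full_shift E0 | forall i, (i < m)%N -> y i = x i]).
have FF : Filter F.
  apply: filter_from_filter; first by exists 0%N.
  move=> m n _ _; exists (maxn m n) => // y /= xy.
  by split=> i im; apply: xy; rewrite leq_max im ?orbT.
suff Fx : F --> x by move=> /Fx [m _ mA]; exists m.
apply/prod_cvgP => i B /discrete_nbhsP Bxi.
by exists i.+1 => // y /= ->.
Qed.

Lemma subspace_nbhsP (E0 : finType) (X : set (full_shift E0)) (x : set_type X)
    (A : set (set_type X)) :
  nbhs x A <-> exists m, forall y : set_type X,
    (forall i, (i < m)%N -> set_val y i = set_val x i) -> A y.
Proof.
split=> [/(@initial_nbhsP _ _ set_val)[B /full_shift_nbhsP[m mB] BA]|[m mA]].
  by exists m => y xy; apply: BA; exact: mB.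
apply/(@initial_nbhsP _ _ set_val); exists [set y | forall i, (i < m)%N -> y i = set_val x i].
  by apply/full_shift_nbhsP; exists m.
by move=> y; exact: mA.
Qed.

Lemma full_shift_compact (E0 : finType) : compact [set: full_shift E0].
Proof.
have -> : [set: full_shift E0] = [set x : full_shift E0 | forall i, setT (x i)].
  by apply/seteqP.
apply: (@tychonoff nat (fun=> discrete_topology E0) (fun=> setT)) => _.
by apply: finite_compact; exact: (@finite_finset E0).
Qed.

End Topology.

(** * Factors of subshifts *)

(** Stated for a relation rather than a map, since a word is read on many different
    points, from which there is no canonical choice. *)
Lemma card_le_rel (T1 T2 : finType) (P : pred T1) (Q : pred T2) (r : T1 -> T2 -> Prop) :
  (forall x, P x -> exists2 y, Q y & r x y) ->
  (forall x x' y, r x y -> r x' y -> x = x') ->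
  (#|P| <= #|Q|)%N.
Proof.
move=> PQ r_inj; have [x0 Px0|P0] := pickP P; last by rewrite eq_card0.
have [y0 _ _] := PQ x0 Px0.
have /choice[g gP] x : exists y, P x -> Q y /\ r x y.
  by have [/PQ[y Qy rxy]|] := boolP (P x); [exists y|exists y0].
have g_inj : {in P &, injective g}.
  by move=> x x' /gP[_ rx] /gP[_ +] gxx'; rewrite -gxx' => /(r_inj _ _ _ rx).
rewrite -(card_in_image g_inj); apply/subset_leq_card/fintype.subsetP => y.
by case/fintype.imageP => x /gP[Qgx _] ->.
Qed.

Section Conjugacy.
Variables (E1 E2 : finType) (X : set (full_shift E1)) (Y : set (full_shift E2)).

Definition window (E : finType) (x : full_shift E) m l : l.-tuple E :=
  [tuple x (m + i)%N | i < l].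

Lemma appearsP (E : finType) (Z : set (full_shift E)) l (w : l.-tuple E) :
  appears Z w <-> exists2 x, Z x & exists m, w = window x m l.
Proof.
split=> -[x Zx [m xw]]; exists x => //; exists m.
  by apply: eq_from_tnth => i; rewrite tnth_mktuple xw.
by move=> i; rewrite xw tnth_mktuple.
Qed.

Variable theta : set_type X -> set_type Y.
Hypothesis X_subshift : subshift X.
Hypothesis theta_cont : continuous theta.
Hypothesis theta_surj : forall y, exists x, theta x = y.

(** The Curtis-Hedlund-Lyndon theorem: theta is a sliding block code. If no window
    size m worked, then points u_m and u'_m would agree up to m while theta u_m and
    theta u'_m have distinct first letters; near a cluster point of the u_m, which
    exists by compactness, this contradicts the continuity of theta. *)
Lemma uniform_window : exists m, forall x x' : set_type X,
  (forall i, (i < m)%N -> set_val x i = set_val x' i) ->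
  set_val (theta x) 0%N = set_val (theta x') 0%N.
Proof.
apply: contrapT => no_m.
have /choice[u uP] m : exists u : set_type X * set_type X,
    (forall i, (i < m)%N -> set_val u.1 i = set_val u.2 i) /\
    set_val (theta u.1) 0%N <> set_val (theta u.2) 0%N.
  apply: contrapT => no_u; apply: no_m; exists m => x x' xx'.
  by apply: contrapT => ?; apply: no_u; exists (x, x').
have [Xc _] := X_subshift.
have Xcompact : compact X by exact: subclosed_compact Xc (@full_shift_compact E1) _.
pose v n := set_val (u n).1.
have vF : ProperFilter (v @ \oo) by exact: fmap_proper_filter.
have [|x [Xx clx]] := Xcompact _ vF.
  by exists 0%N => // n _; exact: (set_mem (valP (u n).1)).
pose x' : set_type X := exist _ x (mem_set Xx).
have /subspace_nbhsP[m mP] : nbhs x' [set y | set_val (theta y) 0%N = set_val (theta x') 0%N].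
  apply: (theta_cont (t := [set z | set_val z 0%N = set_val (theta x') 0%N])).
  by apply/subspace_nbhsP; exists 1%N => z; apply.
have [] := clx [set z | exists2 n, (m <= n)%N & v n = z]
  [set z | forall i, (i < m)%N -> z i = x i].
- by exists m => // n /= mn; exists n.
- by apply/full_shift_nbhsP; exists m.
move=> z [[n mn <-] vnx]; have [uE uN] := uP n; apply: uN.
rewrite (mP (u n).1) // (mP (u n).2) // => i im.
by rewrite -uE; [exact: vnx|exact: leq_trans mn].
Qed.

Hypothesis theta_shift : forall x x' : set_type X,
  set_val x' = shift_map (set_val x) ->
  set_val (theta x') = shift_map (set_val (theta x)).

(** A word of length l of Y is the image of a word of length l + m of X, by the
    sliding block code. *)
Lemma factor_num_words : exists m, forall l, (num_words Y l <= num_words X (l + m))%N.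
Proof.
have [m mP] := uniform_window; have [_ X_shift] := X_subshift.
exists m => l.
have shiftE (x : set_type X) n : exists2 x' : set_type X,
    forall i, set_val x' i = set_val x (n + i)%N &
    forall i, set_val (theta x') i = set_val (theta x) (n + i)%N.
  elim: n => [|n [x' x'E tx'E]]; first by exists x.
  have Xx' : X (shift_map (set_val x')).
    by apply: X_shift; exists (set_val x') => //; exact: (set_mem (valP x')).
  pose x'' : set_type X := exist (fun z => is_true (z \in X)) _ (mem_set Xx').
  exists x'' => i; first by rewrite addSnnS -x'E.
  by rewrite (theta_shift (x := x')) // /shift_map tx'E addSnnS.
have thetaE (x x' : set_type X) n n' :
    (forall i, (i < m)%N -> set_val x (n + i)%N = set_val x' (n' + i)%N) ->
    set_val (theta x) n = set_val (theta x') n'.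
  have [y yE ty] := shiftE x n; have [y' y'E ty'] := shiftE x' n' => xx'.
  rewrite -(addn0 n) -(addn0 n') -ty -ty'; apply: mP => i im.
  by rewrite yE y'E xx'.
apply: (@card_le_rel _ _ _ _ (fun w w' => exists x n,
  w = window (set_val (theta x)) n l /\ w' = window (set_val x) n (l + m))).
- move=> w /asboolP/appearsP[y Yy [n ->]].
  have [x xy] := theta_surj (exist _ y (mem_set Yy)).
  exists (window (set_val x) n (l + m)); last by exists x, n; rewrite xy.
  by apply/asboolP/appearsP; exists (set_val x); [exact: (set_mem (valP x))|exists n].
- move=> w1 w2 w' [x1 [n1 [-> ->]]] [x2 [n2 [-> /(congr1 (@tnth _ _)) x12]]].
  apply: eq_from_tnth => i; rewrite !tnth_mktuple; apply: thetaE => i' i'm.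
  have ilm : (i + i' < l + m)%N by rewrite -addnS leq_add // ltnW.
  have := congr1 (@^~ (Ordinal ilm)) x12; rewrite !tnth_mktuple /=.
  by rewrite !addnA.
Qed.

End Conjugacy.

(** * Growth rates *)
Section Growth.
Variable R : realType.

Lemma cvg_inv_nat : (fun l : nat => (l%:R : R)^-1) @ \oo --> (0 : R).
Proof.
apply/gtr0_cvgV0; last exact: cvgr_idn.
by exists 1%N => // l /= l1; rewrite ltr0n.
Qed.

(** From the rank l0 on, the logarithm of the product of the D i for i < l is
    c + l ln d for a constant c. Shifting l by m1 or m2 only changes the constant,
    which disappears after division by l. *)
Lemma log_growth (D u : nat -> nat) (d m1 m2 l0 : nat) :
  (forall i, 0 < D i)%N -> (forall i, (l0 <= i)%N -> D i = d) ->
  (forall l, u l <= \prod_(i < l + m1) D i)%N ->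
  (forall l, \prod_(i < l) D i <= u (l + m2))%N ->
  (fun l : nat => (l%:R)^-1 * ln (u l)%:R) @ \oo --> ln (d%:R : R).
Proof.
move=> D0 Dd uN Nu; pose N l := (\prod_(i < l) D i)%N.
have N0 l : (0 < N l)%N by apply: prodn_gt0.
pose c := ln ((N l0)%:R : R) - l0%:R * ln d%:R.
have lnN l : (l0 <= l)%N -> ln ((N l)%:R : R) = c + l%:R * ln d%:R.
  move=> /subnK <-; elim: (l - l0)%N => [|n IHn]; first by rewrite subrK.
  rewrite addSn /N big_ord_recr /= -/(N (n + l0)%N) natrM lnM ?posrE ?ltr0n // IHn.
  by rewrite Dd ?leq_addl // -addrA -natr1 mulrDl mul1r.
have u0 l : (m2 <= l)%N -> (0 < u l)%N by move=> /subnK <-; exact: leq_trans (N0 _) (Nu _).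
have bound (b : R) : (fun l : nat => (l%:R)^-1 * (b + l%:R * ln d%:R)) @ \oo --> ln (d%:R : R).
  rewrite -[X in _ --> X]addr0 addrC -{1}(mulr0 b).
  apply: cvg_trans; last apply: (cvgD (cvgM (cvg_cst b) cvg_inv_nat) (cvg_cst (ln d%:R))).
  apply: near_eq_cvg; exists 1%N => // l /= l1.
  by rewrite mulrDr mulrA mulVf ?mul1r ?pnatr_eq0 -?lt0n //= mulrC.
apply: (squeeze_cvgr _ (bound (c - m2%:R * ln d%:R)) (bound (c + m1%:R * ln d%:R))).
exists (l0 + m2)%N => // l /= l0l.
have m2l : (m2 <= l)%N by apply: leq_trans l0l; exact: leq_addl.
have l0l' : (l0 <= l - m2)%N by rewrite leq_subRL // addnC.
apply/andP; split; apply: ler_wpM2l; rewrite ?invr_ge0 //.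
- have := Nu (l - m2)%N; rewrite subnK // -(ler_nat R) => uN'.
  have -> : c - m2%:R * ln d%:R + l%:R * ln d%:R = ln (N (l - m2)%N)%:R :> R.
    by rewrite lnN // natrB // mulrBl -addrA [- _ + _]addrC.
  by rewrite ler_ln // posrE ltr0n // u0.
- have := uN l; rewrite -(ler_nat R) => uN'.
  have -> : c + m1%:R * ln d%:R + l%:R * ln d%:R = ln (N (l + m1)%N)%:R :> R.
    rewrite lnN; last by apply: leq_trans (leq_addr _ _); apply: leq_trans l0l; exact: leq_addr.
    by rewrite natrD mulrDl -addrA [X in _ + X]addrC.
  by rewrite ler_ln // posrE ltr0n // u0.
Qed.

End Growth.

(** * The subshift of itineraries *)
Section CanonicalShift.
Variables (k L K : fieldType) (f : {rmorphism k -> L}) (j : {rmorphism k -> K}).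
Variables (sk : {rmorphism k -> k}) (sL : {rmorphism L -> L}) (sK : {rmorphism K -> K}).
Hypothesis f_diff : diff_morphism sk sL f.
Hypothesis j_diff : diff_morphism sk sK j.
Hypothesis L_sepalg : separably_algebraic f.
Hypothesis K_closed : separably_closed K.
Variable a : seq L.
Hypothesis a_gen : sigma_gen f sL a = setT.
Implicit Types h : points f j.

Local Notation stage := (stage f sL a).
Local Notation deg := (stage_degree f sL a).
Local Notation twist := (@twist k L K f j sL sK).

(** The stages are finite-dimensional over k by the tower law. *)
Lemma stage_base_basis m : exists n (b : 'I_n -> L), is_basis (stage 0) (stage m) b.
Proof.
have S0 := subalgebra_stage f sL a 0.
elim: m => [|m [n [b bB]]].
  exists 1%N, (fun _ => 1); split=> [i|y My|c cM].
  - exact: subalgebra1 S0.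
  - by exists (fun _ => y) => //; rewrite big_ord1 mulr1.
  - by rewrite big_ord1 mulr1 => c0 i; rewrite ord1.
have [c cB] := stage_basis j sL L_sepalg K_closed a m.
have [e eB] := tower_basis S0 (subalgebra_stage f sL a m) (subalgebra_stage f sL a m.+1)
  (@stage_mono _ _ f sL a 0 m (leq0n m)) (@stage_mono _ _ f sL a m m.+1 (leqnSn m)) bB cB.
by eexists; exists e.
Qed.

Lemma stage_finite_dim m : finite_dim f (stage m).
Proof.
have [n [b [Sb b_span _]]] := stage_base_basis m; exists n, b.
have mS := subalgebra_stage f sL a m; have [_ _ SM] := mS.
apply/seteqP; split=> [x /b_span[c + ->]|_ [c _ <-]]; last first.
  apply: (subalgebra_sum _ _ mS) => i; apply: SM => //; exact: subalgebra_base mS.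
rewrite stage0 => c_base.
have /choice[e eE] i : exists e : k, f e = c i by have [e _ <-] := c_base i; exists e.
by exists e => //; apply: eq_bigr => i _; rewrite eE.
Qed.

(** With [stage_finite_dim], the stages are cofinal among the finite-dimensional
    subalgebras, so that they suffice to describe the topology of the points. *)
Lemma finite_dim_sub_stage (M : set L) : finite_dim f M -> exists m, M `<=` stage m.
Proof.
move=> [n [b ->]]; have /choice[e be] := stage_exhausts a_gen.
exists (\max_(i < n) e (b i)) => _ [c _ <-].
set m := \max_(i < n) _; have mS := subalgebra_stage f sL a m; have [_ _ SM] := mS.
apply: (subalgebra_sum _ _ mS) => i; apply: SM; first exact: subalgebra_base mS.
by apply: stage_mono (be _); exact: (@leq_bigmax _ (fun i => e (b i))).
Qed.

Lemma point_space_nbhsP (h : point_space f j) (A : set (point_space f j)) :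
  nbhs h A <-> exists m, forall h' : point_space f j,
    (forall y, stage m y -> set_val h' y = set_val h y) -> A h'.
Proof.
split=> [/(@initial_nbhsP _ _ (@restrictions _ _ _ f j))[B rhB BA]|[m mA]].
  pose F := filter_from setT (fun m => [set h' : points f j |
    forall y, stage m y -> set_val h' y = set_val h y]).
  have FF : Filter F.
    apply: filter_from_filter; first by exists 0%N.
    move=> m n _ _; exists (maxn m n) => // h' /= hh'.
    split=> y Sy; apply: hh'; apply: stage_mono Sy; [exact: leq_maxl|exact: leq_maxr].
  suff Fh : @restrictions _ _ _ f j @ F --> restrictions h.
    by have [m _ mB] := Fh _ rhB; exists m => h' hh'; apply/BA/mB.
  apply/prod_cvgP => M C /discrete_nbhsP ChM.
  have [_ Mfd] := set_mem (valP M); have [m Mm] := finite_dim_sub_stage Mfd.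
  exists m => // h' hh' /=; suff -> : @restrictions _ _ _ f j h' M = @restrictions _ _ _ f j h M by [].
  by apply/funext => x; apply: hh'; apply: Mm; exact: (set_mem (valP x)).
pose M : fd_subalgebra f := exist (fun B => is_true (B \in _)) (stage m)
  (mem_set (conj (subalgebra_stage f sL a m) (stage_finite_dim m))).
apply/(@initial_nbhsP _ _ (@restrictions _ _ _ f j)).
exists [set g | g M = @restrictions _ _ _ f j h M].
  apply: (prod_nbhs_coord (B := [set g | g = @restrictions _ _ _ f j h M])).
  by apply/discrete_nbhsP.
move=> h' /= hh'; apply: mA => y my.
pose y' : set_type (set_val M) := exist (fun z => is_true (z \in set_val M)) y (mem_set my).
exact: (congr1 (fun g : set_type (set_val M) -> K => g y') hh').
Qed.

(* Any finite set of letters that contains all the tuples h(a) will do. *)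
Variable letters : seq (seq K).
Hypothesis lettersP : forall h, [seq set_val h x | x <- a] \in letters.

Definition itinerary h : full_shift (seq_sub letters) :=
  fun i => SeqSub (lettersP (iter i twist h)).

(** The i-th letter of the itinerary is sent by the i-th power of the endomorphism
    of K to h (sigma^i(a)), and this power is injective. *)
Lemma itinerary_agreeP l h h' : (forall i, (i < l)%N -> itinerary h i = itinerary h' i) <->
  (forall y, stage l y -> set_val h y = set_val h' y).
Proof.
have itineraryE i : itinerary h i = itinerary h' i <->
    {in a, forall x, set_val h (iter i sL x) = set_val h' (iter i sL x)}.
  split=> [/(congr1 val)/= /eq_in_map hh' x ax|hh'].
    by rewrite -!(iter_twistE f_diff j_diff L_sepalg K_closed) hh'.
  apply: val_inj; apply/eq_in_map => x ax.
  have := hh' x ax; rewrite -!(iter_twistE f_diff j_diff L_sepalg K_closed).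
  by elim: i {hh'} (set_val _ x) (set_val _ x) => //= i IHi y z /fmorph_inj /IHi.
split=> [hh'|hh' i il]; last by apply/itineraryE => x ax; apply: hh'; exact: mem_stage.
have stage_hom (g : points f j) : hom_on f j (stage l) (set_val g).
  by apply: hom_on_sub (points_hom g).
by apply: eq_on_stage => // i il; apply/itineraryE; exact: hh'.
Qed.

Lemma itinerary_inj h h' : itinerary h = itinerary h' -> h = h'.
Proof.
move=> hh'; apply: points_inj => y; have [l ly] := stage_exhausts a_gen y.
by apply: ((itinerary_agreeP l h h').1 _ y ly) => i _; rewrite hh'.
Qed.

Lemma itinerary_iter_twist m h i : itinerary (iter m twist h) i = itinerary h (m + i).
Proof. by apply: val_inj; rewrite /= -iterD addnC. Qed.

(** A limit x of itineraries is an itinerary: its first n letters are those of some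
    morphism h_n, the restrictions of the h_n to the stages n are coherent, and the
    morphism obtained by gluing them has itinerary x. *)
Lemma subshift_itinerary : subshift (range itinerary).
Proof.
split=> [x clx|_ [_ [h _ <-] <-]]; last first.
  exists (twist h) => //; apply/funext => i.
  by rewrite -[twist h]/(iter 1 twist h) itinerary_iter_twist.
have /choice[h_ hx] n : exists h, forall i, (i < n)%N -> itinerary h i = x i.
  have xn : nbhs x [set y : full_shift _ | forall i, (i < n)%N -> y i = x i].
    by apply/full_shift_nbhsP; exists n.
  by have [_ [[h _ <-] hx]] := clx _ xn; exists h.
have [n|y|n|n y ny|g gT gE] :=
    hom_glue (M := stage) (h_ := fun n => set_val (h_ n)) (f := f) (j := j).
- by apply: stage_mono.
- exact: stage_exhausts a_gen y.
- by apply: hom_on_sub (points_hom (h_ n)).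
- by apply: ((itinerary_agreeP n _ _).1 _ y ny) => i il; rewrite !hx // ltnW.
have [h hg] := hom_point gT; exists h => //; apply/funext => i.
rewrite -(hx i.+1) //; move: i (ltnSn i) => i.
have /itinerary_agreeP : forall y, stage i.+1 y -> set_val h y = set_val (h_ i.+1) y.
  by move=> y iy; rewrite hg (gE i.+1).
by apply.
Qed.

Lemma presents_itinerary : presents f j sL sK (range itinerary).
Proof.
have itineraryX h : itinerary h \in range itinerary by apply/mem_set; exists h.
pose phi h : set_type (range itinerary) :=
  exist (fun x => is_true (x \in range itinerary)) (itinerary h) (itineraryX h).
have /choice[psi psiE] (x : set_type (range itinerary)) : exists h, phi h = x.
  by have [h _ hx] := set_mem (valP x); exists h; apply: val_inj.
have phiK : cancel phi psi.
  by move=> h; apply: itinerary_inj; exact: (congr1 (fun x => set_val x) (psiE (phi h))).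
exists (phi : point_space f j -> _), (psi : _ -> point_space f j); split=> //.
- move=> h A /subspace_nbhsP[m mA]; apply/point_space_nbhsP; exists m => h' hh'.
  by apply: mA => i; exact: ((itinerary_agreeP m h' h).2 hh' i).
- move=> x A /point_space_nbhsP[m mA]; apply/subspace_nbhsP; exists m => y xy.
  apply: mA; apply: (itinerary_agreeP m (psi y) (psi x)).1 => i im; have := xy i im.
  by rewrite -{1}(psiE x) -{1}(psiE y).
- by move=> h; apply/funext => i; exact: (itinerary_iter_twist 1 h i).
Qed.

(** By [itinerary_agreeP], the words of length l correspond to the restrictions of
    points to the stage l; all the morphisms on this stage arise in this way, since
    they extend to L. *)
Lemma num_words_itinerary l : num_words (range itinerary) l = (\prod_(i < l) deg i)%N.
Proof.
have [vs [uvs <- vsP]] := stage_values_enum j sL L_sepalg K_closed a l.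
rewrite -(card_seq_sub uvs).
have stage_hom h : hom_on f j (stage l) (set_val h) by apply: hom_on_sub (points_hom h).
pose r (w : l.-tuple (seq_sub letters)) (v : seq_sub vs) :=
  exists2 h, w = window (itinerary h) 0 l & val v = stage_values sL a (set_val h) l.
have windowP h h' : window (itinerary h) 0 l = window (itinerary h') 0 l <->
    forall i, (i < l)%N -> itinerary h i = itinerary h' i.
  split=> [hh' i il|hh'].
    by have := congr1 (fun w => tnth w (Ordinal il)) hh'; rewrite !tnth_mktuple.
  by apply: eq_from_tnth => i; rewrite !tnth_mktuple hh' ?ltn_ord.
have rP w v w' v' : r w v -> r w' v' -> w = w' <-> v = v'.
  move=> [h -> vh] [h' -> vh']; rewrite windowP itinerary_agreeP.
  rewrite -(eq_stage_values (stage_hom h) (stage_hom h')) -vh -vh'.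
  by split=> [/val_inj|->].
have value_in h : stage_values sL a (set_val h) l \in vs.
  by apply/vsP; exists (set_val h).
apply/eqP; rewrite eqn_leq; apply/andP; split.
- apply: (@card_le_rel _ _ _ _ r) => [w /asboolP/appearsP[_ [h _ <-] [m ->]]|w w' v wv w'v].
    exists (SeqSub (value_in (iter m twist h))) => //; exists (iter m twist h) => //.
    by apply: eq_from_tnth => i; rewrite !tnth_mktuple itinerary_iter_twist.
  by apply/(rP _ _ _ _ wv w'v).
- apply: (@card_le_rel _ _ _ _ (fun v w => r w v)) => [v _|v v' w wv wv'].
    have /vsP[g gM gv] := valP v.
    have [g' g'T g'g] := stage_hom_extends L_sepalg K_closed a_gen gM.
    have [h hg'] := hom_point g'T.
    exists (window (itinerary h) 0 l).
      by apply/asboolP/appearsP; exists (itinerary h); [exists h|exists 0%N].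
    exists h => //; rewrite -[LHS]gv; apply: (eq_stage_values gM (stage_hom h)).2 => y ly.
    by rewrite hg' g'g.
  by apply/(rP _ _ _ _ wv wv').
Qed.

End CanonicalShift.

(** * The entropy of any presenting subshift *)
Section EntropyValue.
Variables (R : realType) (k L K : fieldType).
Variables (f : {rmorphism k -> L}) (j : {rmorphism k -> K}).
Variables (sk : {rmorphism k -> k}) (sL : {rmorphism L -> L}) (sK : {rmorphism K -> K}).
Hypothesis f_diff : diff_morphism sk sL f.
Hypothesis j_diff : diff_morphism sk sK j.
Hypothesis L_sepalg : separably_algebraic f.
Hypothesis K_closed : separably_closed K.

Lemma presented_num_words (E1 E2 : finType)
    (X : set (full_shift E1)) (Y : set (full_shift E2)) :
  subshift X -> presents f j sL sK X -> presents f j sL sK Y ->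
  exists m, forall l, (num_words Y l <= num_words X (l + m))%N.
Proof.
move=> Xsub [phi [psi [phiK psiK phi_c psi_c phi_s]]] [phi' [psi' [phiK' psiK' phi_c' _ phi_s']]].
apply: (@factor_num_words _ _ _ _ (phi' \o psi)) => //.
- by move=> x; apply: continuous_comp; [exact: psi_c|exact: phi_c'].
- by move=> y; exists (phi (psi' y)); rewrite /= phiK psiK'.
- move=> x x' xx' /=; rewrite -phi_s'; congr (set_val (phi' _)).
  apply: (can_inj phiK); apply: val_inj; rewrite psiK.
  by rewrite -[val _]/(set_val _) -[RHS]/(set_val _) phi_s psiK.
Qed.

Lemma letters_exist (a : seq L) : exists letters : seq (seq K),
  forall h : points f j, [seq set_val h x | x <- a] \in letters.
Proof.
have [vs [_ _ vsP]] := stage_values_enum j sL L_sepalg K_closed a 1.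
exists (map (head [::]) vs) => h; apply/mapP.
exists (stage_values sL a (set_val h) 1) => //.
by apply/vsP; exists (set_val h) => //; apply: hom_on_sub (points_hom h).
Qed.

Lemma stage_degree_gt0 a l : (0 < stage_degree f sL a l)%N.
Proof.
have [b [_ b_span _]] := stage_basis j sL L_sepalg K_closed a l.
rewrite lt0n; apply/eqP => d0; rewrite {}d0 in b b_span.
have [|c _ /eqP] := b_span 1; first exact: subalgebra1 (subalgebra_stage _ _ _ _).
by rewrite big_ord0 oner_eq0.
Qed.

(** The tuple a and the subshift X are arbitrary: this is what makes both the limit
    degree and the entropy independent of the choices in their definitions. *)
Lemma presented_entropy (a : seq L) (d : nat) (E0 : finType) (X : set (full_shift E0)) :
  sigma_gen f sL a = setT ->
  (\forall i \near \oo,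
     ext_degree (sigma_gen_upto f sL a i) (sigma_gen_upto f sL a i.+1) = d) ->
  subshift X -> presents f j sL sK X ->
  subshift_entropy R X = ln (d%:R : R).
Proof.
move=> a_gen [l0 _ dP] Xsub Xpres.
have [letters lettersP] := letters_exist a.
have Csub := subshift_itinerary f_diff j_diff L_sepalg K_closed a_gen lettersP.
have Cpres := presents_itinerary f_diff j_diff L_sepalg K_closed a_gen lettersP.
have Cwords := num_words_itinerary f_diff j_diff L_sepalg K_closed a_gen lettersP.
have [m1 XC] := presented_num_words Csub Cpres Xpres.
have [m2 CX] := presented_num_words Xsub Xpres Cpres.
apply: cvg_lim; first exact: Rhausdorff.
apply: (@log_growth R (stage_degree f sL a) (num_words X) d m1 m2 l0.+1).
- exact: stage_degree_gt0.
- by case=> [//|i] li; exact: dP.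
- by move=> l; rewrite -Cwords.
- by move=> l; rewrite -Cwords.
Qed.

End EntropyValue.

Theorem proposition5p19 (R : realType) (k L kbar : fieldType)
    (sk : {rmorphism k -> k}) (sL : {rmorphism L -> L})
    (sbar : {rmorphism kbar -> kbar})
    (f : {rmorphism k -> L}) (j : {rmorphism k -> kbar})
    (f_diff : diff_morphism sk sL f) (j_diff : diff_morphism sk sbar j)
    (j_sepclosure : separable_closure j)
    (L_sepalg : separably_algebraic f)
    (L_fg : finitely_sigma_generated f sL) :
  entropy f j sL sbar R = ln ((limit_degree f sL)%:R).
Proof.
have [_ K_closed] := j_sepclosure; have [a a_gen] := L_fg.
have [|b b_gen bd] := @xgetPex _ 0%N [set d | exists2 a : seq L, sigma_gen f sL a = setT &
    \forall i \near \oo,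
      ext_degree (sigma_gen_upto f sL a i) (sigma_gen_upto f sL a i.+1) = d].
  have [l0 dP] := stage_degree_ultimately j f_diff L_sepalg K_closed a.
  exists (stage_degree f sL a l0), a => //; exists l0 => // i /= li.
  by apply: dP; exact: leqW.
have [|E0 [X [Xsub Xpres]]] := @xgetPex R 0
  [set r | exists (E0 : finType) (X : set (full_shift E0)),
    [/\ subshift X, presents f j sL sbar X & r = subshift_entropy R X]].
  have [letters lettersP] := letters_exist j sL L_sepalg K_closed a.
  pose X := range (@itinerary _ _ _ _ _ sL sbar a letters lettersP).
  exists (subshift_entropy R X), (seq_sub letters), X; split=> //.
  - exact (subshift_itinerary f_diff j_diff L_sepalg K_closed a_gen lettersP).
  - exact (presents_itinerary f_diff j_diff L_sepalg K_closed a_gen lettersP).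
rewrite -/(entropy f j sL sbar R) => ->.
exact (presented_entropy R f_diff j_diff L_sepalg K_closed b_gen bd Xsub Xpres).
Qed.
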